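(* Let $R$, $I$, $(F_\bullet,d_\bullet)$, $F_1'$, $e_0^1,\dots,e_0^t$, $\mathfrak a_i$, $(G^i_\bullet,m^i_\bullet)$, $q_1^i,q_2^i$ and the iterated trimming complex $(T_\bullet,\ell_\bullet)$ be as in the context, with $F_\bullet$ and all $G^i_\bullet$ length $3$ DG-algebras, and let $T_\bullet$ carry a DG-algebra structure of the form described in the context. Assume that the complexes $F_\bullet$ and $G^i_\bullet$ ($1\le i\le t$) are minimal, and write $\overline{\,\cdot\,}:=\cdot\otimes_Rk$. Then the only possible nontrivial products (of elements of positive degree) in the algebra $\overline{T_\bullet}$ are $$\overline{F_1'}\cdot_T\overline{F_1'},\quad \overline{F_1'}\cdot_T\overline{F_2},\quad \overline{F_1'}\cdot_T\overline{G_1^i},\quad \overline{G_1^i}\cdot_T\overline{F_2},\quad\text{and}\quad \overline{F_1'}\cdot_T\overline{G_2^i}\qquad(1\le i\le t).$$ Moreover, the map $\overline{T_\bullet}\to\overline{F_\bullet}$ defined by $\overline{f_i}\mapsto\overline{f_i}$ (for $f_i$ in the $F_i$-summand, respectively $F_1'$-summand for $i=1$) and $\overline{g_i^j}\mapsto0$ (for $g_i^j\in G_i^j$, $i\geq 1$) is a homomorphism of $k$-algebras.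
   Context: A DG-algebra over a commutative Noetherian ring $R$ is a complex of finitely generated free $R$-modules $(F_\bullet,d_\bullet)$ with a unitary associative multiplication satisfying $F_i\cdot F_j\subseteq F_{i+j}$, $d(f_if_j)=d(f_i)f_j+(-1)^if_id(f_j)$, $f_if_j=(-1)^{ij}f_jf_i$, and $f_i^2=0$ for $i$ odd (where $f_i\in F_i$). The product of a DG-algebra $F_\bullet$ is written $\cdot_F$. Setting. $(R,\mathfrak m,k)$ is a regular local ring (alternatively, a standard graded polynomial ring over a field $k$ with all data homogeneous). $I\subseteq R$ is an ideal and $(F_\bullet,d_\bullet)$ is a free resolution of $R/I$ with $F_0=R$. Write $F_1=F_1'\oplus\bigoplus_{i=1}^tRe_0^i$, where each $e_0^i$ generates a free direct summand, and decompose $d_2=d_2'+d_0^1+\dots+d_0^t$ with $d_2'\in\operatorname{Hom}_R(F_2,F_1')$ and $d_0^i\in\operatorname{Hom}_R(F_2,Re_0^i)$. For each $i$ let $\mathfrak a_i$ be an ideal with $d_0^i(F_2)\subseteq\mathfrak a_ie_0^i$ and $(G^i_\bullet,m^i_\bullet)$ a free resolution of $R/\mathfrak a_i$ with $G_0^i=R$. All of $F_\bullet,G^i_\bullet$ have length $3$. Let $q_1^i:F_2\to G_1^i$ and $q_2^i:F_3\to G_2^i$ be maps with $m_1^i(q_1^i(f_2))\,e_0^i=d_0^i(f_2)$ and $m_2^i\circ q_2^i=q_1^i\circ d_3$ (such maps exist). The iterated trimming complex $T_\bullet$ has $T_0=R$, $T_1=F_1'\oplus\bigoplus_iG_1^i$,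 $T_2=F_2\oplus\bigoplus_iG_2^i$, $T_3=F_3\oplus\bigoplus_iG_3^i$ and differentials $\ell_1(f_1+\sum g_1^i)=d_1(f_1)-\sum_i m_1^i(g_1^i)d_1(e_0^i)$, $\ell_2(f_2+\sum g_2^i)=d_2'(f_2)-\sum_iq_1^i(f_2)+\sum_im_2^i(g_2^i)$, $\ell_3(f_3+\sum g_3^i)=d_3(f_3)+\sum_iq_2^i(f_3)+\sum_im_3^i(g_3^i)$. It is a free resolution of $R/J$, $J=d_1(F_1')+\sum_i\mathfrak a_i\,d_1(e_0^i)$. Form of the DG-algebra structure $\cdot_T$ on $T_\bullet$ (such a structure exists). For $z\in T_n$ ($n=2,3$), $[z]_F\in F_n$ and $[z]_k\in G_n^k$ denote components; $f_1,f_1'\in F_1'$, $f_2\in F_2$, $g_a^i\in G_a^i$: (1) $[f_1\cdot_T f_1']_F=f_1\cdot_F f_1'$, $m_2^k([f_1\cdot_T f_1']_k)=q_1^k(f_1\cdot_F f_1')$. (2) $[f_1\cdot_T g_1^i]_F=m_1^i(g_1^i)e_0^i\cdot_F f_1$, $m_2^k([f_1\cdot_T g_1^i]_k)=\delta_{ik}d_1(f_1)g_1^i+m_1^i(g_1^i)q_1^k(e_0^i\cdot_F f_1)$. (3) $g_1^i\cdot_T {g'}_1^i=-d_1(e_0^i)\,g_1^i\cdot_{G^i}{g'}_1^i$. (4) For $i<j$: $[g_1^i\cdot_T g_1^j]_F=m_1^i(g_1^i)m_1^j(g_1^j)e_0^i\cdot_F e_0^j$, $m_2^k([g_1^i\cdot_T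 g_1^j]_k)=m_1^i(g_1^i)m_1^j(g_1^j)q_1^k(e_0^i\cdot_F e_0^j)+\delta_{ki}m_1^j(g_1^j)d_1(e_0^j)g_1^i-\delta_{kj}m_1^i(g_1^i)d_1(e_0^i)g_1^j$. (5) $[f_1\cdot_T f_2]_F=f_1\cdot_F f_2$, $m_3^k([f_1\cdot_T f_2]_k)=-\big([f_1\cdot_T d_2'(f_2)]_k-\sum_j[f_1\cdot_T q_1^j(f_2)]_k+q_2^k(f_1\cdot_F f_2)\big)$. (6) $[f_1\cdot_T g_2^i]_F=0$, $m_3^k([f_1\cdot_T g_2^i]_k)=\delta_{ik}d_1(f_1)g_2^i-[f_1\cdot_T m_2^i(g_2^i)]_k$. (7) $g_1^i\cdot_T g_2^i=-d_1(e_0^i)\,g_1^i\cdot_{G^i}g_2^i$. (8) For $i\ne j$: $[g_1^i\cdot_T g_2^j]_F=0$, $m_3^k([g_1^i\cdot_T g_2^j]_k)=-[g_1^i\cdot_T m_2^j(g_2^j)]_k-\delta_{kj}m_1^i(g_1^i)d_1(e_0^i)g_2^j$. (9) $[g_1^i\cdot_T f_2]_F=-m_1^i(g_1^i)e_0^i\cdot_F f_2$, $m_3^k([g_1^i\cdot_T f_2]_k)=-\delta_{ik}d_1(e_0^i)\,g_1^i\cdot_{G^i}q_1^i(f_2)+[d_2'(f_2)\cdot_T g_1^i]_k+\sum_{l\ne i}[g_1^i\cdot_T q_1^l(f_2)]_k+m_1^i(g_1^i)q_2^k(e_0^i\cdot_F f_2)$. *)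

(* Defs.v *)
From HB Require Import structures.
From mathcomp Require Import all_boot all_order all_algebra.
From mathcomp.multinomials Require Import mpoly.

Set Implicit Arguments.
Unset Strict Implicit.
Unset Printing Implicit Defensive.

Import GRing.Theory.
Local Open Scope ring_scope.

(* Ideals are Prop-valued, since membership in an ideal of an arbitrary       *)
(* Noetherian ring need not be decidable.                                     *)
Section CommutativeAlgebra.
Variable R : comNzRingType.

Definition is_ideal (I : R -> Prop) : Prop :=
  [/\ I 0, forall x y, I x -> I y -> I (x + y) & forall a x, I x -> I (a * x)].

Definition ideal_sub (I J : R -> Prop) : Prop := forall x, I x -> J x.

Definition is_prime_ideal (P : R -> Prop) : Prop :=
  [/\ is_ideal P, ~ P 1 & forall x y, P (x * y) -> P x \/ P y].

Definition is_maximal_ideal (M : R -> Prop) : Prop :=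
  [/\ is_ideal M, ~ M 1 &
      forall J, is_ideal J -> ideal_sub M J -> ~ J 1 -> ideal_sub J M].

Definition generated_by (s : seq R) (I : R -> Prop) : Prop :=
  forall x, I x <-> exists c : 'I_(size s) -> R, x = \sum_i c i * s`_i.

Definition noetherian : Prop :=
  forall I : R -> Prop, is_ideal I -> exists s : seq R, generated_by s I.

Definition is_local (m : R -> Prop) : Prop :=
  is_maximal_ideal m /\
  forall m', is_maximal_ideal m' -> forall x, m' x <-> m x.

Definition prime_chain (l : nat) (P : nat -> R -> Prop) : Prop :=
  (forall i, (i <= l)%N -> is_prime_ideal (P i)) /\
  (forall i, (i < l)%N ->
     ideal_sub (P i) (P i.+1) /\ ~ ideal_sub (P i.+1) (P i)).

Definition krull_dim (n : nat) : Prop :=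
  (exists P, prime_chain n P) /\ (forall l P, prime_chain l P -> (l <= n)%N).

Definition regular_local_ring (m : R -> Prop) : Prop :=
  [/\ noetherian, is_local m &
      exists2 s : seq R, krull_dim (size s) & generated_by s m].

End CommutativeAlgebra.

Definition residue_field (R : comNzRingType) (k : fieldType) (m : R -> Prop)
    (pi : {rmorphism R -> k}) : Prop :=
  (forall y, exists x, pi x = y) /\ (forall x, m x <-> pi x = 0).

(* A graded finitely generated free module is given by its ranks r, with      *)
(* 'rV[R]_(r n) in degree n. A differential d lowers the degree by one, and   *)
(* d 0 is the zero map. A multiplication is a family mul i j n giving the     *)
(* component of degree n of the product of elements of degrees i and j; it    *)
(* is required to vanish unless n = i + j. This avoids transports along       *)
(* equalities such as (i + j) + l = i + (j + l).                              *)
Definition diffs (R : comNzRingType) (r : nat -> nat) : Type :=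
  forall n, {linear 'rV[R]_(r n) -> 'rV[R]_(r n.-1)}.

Definition prods (R : comNzRingType) (r : nat -> nat) : Type :=
  forall i j n, 'rV[R]_(r i) -> 'rV[R]_(r j) -> 'rV[R]_(r n).

Section DGAlgebras.
Variables (R : comNzRingType) (r : nat -> nat).

Definition is_complex (d : diffs R r) : Prop :=
  (forall x, d 0%N x = 0) /\ (forall n x, d n.-1 (d n x) = 0).

Record is_dg_algebra (d : diffs R r) (one : 'rV[R]_(r 0)) (mul : prods R r) :
    Prop := {
  dg_complex : is_complex d;
  dg_degree : forall i j n x y, n <> (i + j)%N -> mul i j n x y = 0;
  dg_linearl : forall i j n y, linear (fun x => mul i j n x y);
  dg_linearr : forall i j n x, linear (mul i j n x);
  dg_mul1l : forall n x, mul 0%N n n one x = x;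
  dg_mul1r : forall n x, mul n 0%N n x one = x;
  dg_assoc : forall i j l n x y z,
    mul (i + j)%N l n (mul i j (i + j)%N x y) z =
    mul i (j + l)%N n x (mul j l (j + l)%N y z);
  dg_leibniz : forall i j x y,
    d (i + j)%N (mul i j (i + j)%N x y) =
    mul i.-1 j (i + j).-1 (d i x) y
    + (-1) ^+ i *: mul i j.-1 (i + j).-1 x (d j y);
  dg_comm : forall i j n x y, mul i j n x y = (-1) ^+ (i * j) *: mul j i n y x;
  dg_odd_sqr : forall i n x, odd i -> mul i i n x x = 0
}.

(* As 'rV[R]_r is free, d(F_n) is contained in m F_(n-1) exactly when the     *)
(* entries of the values of d lie in m.                                       *)
Definition minimal_complex (m : R -> Prop) (d : diffs R r) : Prop :=
  forall n x b, m (d n x 0 b).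

End DGAlgebras.

(* The algebra structure on F (x)_R k, where F is free with ranks r and       *)
(* F (x)_R k is 'rV[k]_(r n) in degree n, with map_mx pi as the canonical     *)
(* map F_n -> F_n (x)_R k.                                                    *)
Definition base_change (R : comNzRingType) (k : fieldType)
    (pi : {rmorphism R -> k}) (r : nat -> nat) (mul : prods R r) :
    forall i j n, 'rV[k]_(r i) -> 'rV[k]_(r j) -> 'rV[k]_(r n) :=
  fun i j n u v => \sum_a \sum_b
    (u 0 a * v 0 b) *: map_mx pi (mul i j n (delta_mx 0 a) (delta_mx 0 b)).

Lemma base_changeE (R : comNzRingType) (k : fieldType)
    (pi : {rmorphism R -> k}) (r : nat -> nat) (d : diffs R r) one mul i j n
    (x : 'rV[R]_(r i)) (y : 'rV[R]_(r j)) :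
  is_dg_algebra d one mul ->
  base_change pi mul n (map_mx pi x) (map_mx pi y) =
  map_mx pi (mul i j n x y).
Proof.
move=> A.
pose fl b : 'rV[R]_(r i) -> 'rV[R]_(r n) := fun x => mul i j n x b.
pose L b := GRing.isLinear.Build R _ _ _ (fl b) (dg_linearl A n b).
pose Lf b : {linear 'rV[R]_(r i) -> 'rV[R]_(r n)} := HB.pack (fl b) (L b).
pose S a := GRing.isLinear.Build R _ _ _ (mul i j n a) (dg_linearr A n a).
pose Sf a : {linear 'rV[R]_(r j) -> 'rV[R]_(r n)} := HB.pack (mul i j n a) (S a).
rewrite -[mul i j n x y]/(Lf y x) {2}(row_sum_delta x) linear_sum raddf_sum.
apply: eq_bigr => a _; rewrite linearZ /=.
rewrite -[fl y _]/(Sf (delta_mx 0 a) y) {2}(row_sum_delta y) linear_sum.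
rewrite scaler_sumr raddf_sum; apply: eq_bigr => b _.
by rewrite linearZ scalerA /= map_mxZ !mxE rmorphM.
Qed.

(* Ranks of a complex of length 3 whose term of degree 0 is R = 'rV[R]_1.     *)
Definition rk3 (a b c : nat) : nat -> nat :=
  fun n => match n with 0 => 1 | 1 => a | 2 => b | 3 => c | _ => 0 end.

Definition sc (R : comNzRingType) (x : 'rV[R]_1) : R := x 0 0.

Definition unit1 (R : comNzRingType) : 'rV[R]_1 := const_mx 1.

Definition is_resolution (R : comNzRingType) (a b c : nat)
    (d : diffs R (rk3 a b c)) (I : R -> Prop) : Prop :=
  [/\ is_complex d,
      forall n x, d n.+1 x = 0 -> exists y, d n.+2 y = x &
      forall c, I c <-> exists x, sc (d 1%N x) = c].

(* F_1 = F_1' (+) R e_0^1 (+) ... (+) R e_0^t, with F_1' of rank f1 and the   *)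
(* last t coordinates those along the e_0^i.                                  *)
Record trimming_data (R : comNzRingType) := TrimmingData {
  ntrim : nat;
  f1 : nat; f2 : nat; f3 : nat;
  g1 : 'I_ntrim -> nat; g2 : 'I_ntrim -> nat; g3 : 'I_ntrim -> nat;
  dF : diffs R (rk3 (f1 + ntrim) f2 f3);
  mulF : prods R (rk3 (f1 + ntrim) f2 f3);
  dG : forall i, diffs R (rk3 (g1 i) (g2 i) (g3 i));
  mulG : forall i, prods R (rk3 (g1 i) (g2 i) (g3 i));
  idI : R -> Prop;
  ida : 'I_ntrim -> R -> Prop;
  q1 : forall i, {linear 'rV[R]_f2 -> 'rV[R]_(g1 i)};
  q2 : forall i, {linear 'rV[R]_f3 -> 'rV[R]_(g2 i)}
}.

Arguments dF {R} D n : rename.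
Arguments mulF {R} D i j n : rename.
Arguments mulG {R} D l i j n : rename.
Arguments dG {R} D i : rename.
Arguments ida {R} D i : rename.
Arguments q1 {R} D i : rename.
Arguments q2 {R} D i : rename.
Arguments g1 {R} D i : rename.
Arguments g2 {R} D i : rename.
Arguments g3 {R} D i : rename.

Section Trimming.
Variables (R : comNzRingType) (D : trimming_data R).
Notation t := (ntrim D).

Definition rkF : nat -> nat := rk3 (f1 D + t) (f2 D) (f3 D).
Definition rkF' : nat -> nat := rk3 (f1 D) (f2 D) (f3 D).
Definition rkG (i : 'I_t) : nat -> nat := rk3 (g1 D i) (g2 D i) (g3 D i).

Definition rkT (n : nat) : nat :=
  if n is p.+1 then (rkF' p.+1 + \sum_(i < t) rkG i p.+1)%N else 1%N.

(* Coordinates in T, over any coefficients: they serve for T, for T (x)_R k,  *)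
(* and for row vectors of internal degrees.                                   *)
Section Coordinates.
Variable S : nmodType.

Definition inT n (u : 'rV[S]_(rkF' n.+1)) (v : forall i, 'rV[S]_(rkG i n.+1)) :
  'rV[S]_(rkT n.+1) := row_mx u (\mxrow_i v i).

Definition inF n (u : 'rV[S]_(rkF' n.+1)) : 'rV[S]_(rkT n.+1) :=
  inT u (fun=> 0).

Definition inG n i (u : 'rV[S]_(rkG i n.+1)) : 'rV[S]_(rkT n.+1) :=
  inT 0 (dfwith (fun=> 0) u).

Definition prF n (z : 'rV[S]_(rkT n.+1)) : 'rV[S]_(rkF' n.+1) := lsubmx z.

Definition prG n (k : 'I_t) (z : 'rV[S]_(rkT n.+1)) : 'rV[S]_(rkG k n.+1) :=
  @submxrow S t (fun i => rkG i n.+1) 1 (rsubmx z) k.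

Definition F'_to_F n : 'rV[S]_(rkF' n) -> 'rV[S]_(rkF n) :=
  match n with 1 => fun u => row_mx u 0 | _ => id end.

Definition F_to_F' n : 'rV[S]_(rkF n) -> 'rV[S]_(rkF' n) :=
  match n with 1 => fun u => lsubmx u | _ => id end.

Definition T_to_F n : 'rV[S]_(rkT n) -> 'rV[S]_(rkF n) :=
  match n with 0 => id | p.+1 => fun z => F'_to_F (prF z) end.

End Coordinates.

(* delta_(i k) u, as an element of G_n^k *)
Definition deltaG n i (u : 'rV[R]_(rkG i n)) (k : 'I_t) : 'rV[R]_(rkG k n) :=
  dfwith (fun i => 0 : 'rV[R]_(rkG i n)) u k.

Definition e0 (i : 'I_t) : 'rV[R]_(rkF 1) := row_mx 0 (delta_mx 0 i).

Definition d2' (x : 'rV[R]_(rkF 2)) : 'rV[R]_(rkF' 1) := F_to_F' (dF D 2%N x).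

Definition d0 (i : 'I_t) (x : 'rV[R]_(rkF 2)) : 'rV[R]_(rkF 1) :=
  @rsubmx R 1 (f1 D) t (dF D 2%N x) 0 i *: e0 i.

Definition d1F' (x : 'rV[R]_(rkF' 1)) : R := sc (dF D 1%N (F'_to_F x)).

Definition d1e (i : 'I_t) : R := sc (dF D 1%N (e0 i)).

Definition m1 (i : 'I_t) (x : 'rV[R]_(rkG i 1)) : R := sc (dG D i 1%N x).

Record is_trimming_data : Prop := {
  ideal_idI : is_ideal (idI D);
  ideal_ida : forall i, is_ideal (ida D i);
  dgF : is_dg_algebra (dF D) (unit1 R) (mulF D);
  dgG : forall i, is_dg_algebra (dG D i) (unit1 R) (mulG D i);
  resF : is_resolution (dF D) (idI D);
  resG : forall i, is_resolution (dG D i) (ida D i);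
  d0_sub : forall i (x : 'rV[R]_(rkF 2)),
    exists2 a, ida D i a & d0 i x = a *: e0 i;
  q1P : forall i (x : 'rV[R]_(rkF 2)), m1 (q1 D i x) *: e0 i = d0 i x;
  q2P : forall i (x : 'rV[R]_(rkF 3)), dG D i 2%N (q2 D i x) = q1 D i (dF D 3%N x)
}.

Definition ell1 (z : 'rV[R]_(rkT 1)) : 'rV[R]_(rkT 0) :=
  dF D 1%N (F'_to_F (prF z)) - \sum_i m1 (prG i z) *: dF D 1%N (e0 i).

Definition ell2 (z : 'rV[R]_(rkT 2)) : 'rV[R]_(rkT 1) :=
  @inT R 0 (d2' (prF z)) (fun i => dG D i 2%N (prG i z) - q1 D i (prF z)).

Definition ell3 (z : 'rV[R]_(rkT 3)) : 'rV[R]_(rkT 2) :=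
  @inT R 1 (dF D 3%N (prF z)) (fun i => q2 D i (prF z) + dG D i 3%N (prG i z)).

Fact inT_linear n a u u' v v' w :
  (forall i, w i = a *: v i + v' i) ->
  @inT R n (a *: u + u') w = a *: inT u v + inT u' v'.
Proof.
move=> wE; rewrite /inT scale_row_mx add_row_mx; congr row_mx.
apply/matrixP => i j; rewrite !mxE.
by rewrite wE !mxE.
Qed.

Fact prF_linear n : linear (@prF R n).
Proof. by move=> a x y; apply/matrixP => i j; rewrite !mxE. Qed.

Fact prG_linear n k : linear (@prG R n k).
Proof. by move=> a x y; apply/matrixP => i j; rewrite !mxE. Qed.

Fact ell1_linear : linear ell1.
Proof.
move=> a x y; rewrite /ell1 !prF_linear.
have -> : F'_to_F (a *: prF x + prF y) =
    a *: F'_to_F (prF x) + F'_to_F (prF y) :> 'rV[R]_(rkF 1).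
  by rewrite /= scale_row_mx add_row_mx scaler0 addr0.
rewrite linearP scalerBr scaler_sumr addrACA -opprD -big_split /=.
congr (_ - _); apply: eq_bigr => i _.
by rewrite prG_linear /m1 linearP /sc !mxE scalerA -scalerDl.
Qed.

Fact ell2_linear : linear ell2.
Proof.
move=> a x y; rewrite /ell2 prF_linear.
have -> : d2' (a *: prF x + prF y) = a *: d2' (prF x) + d2' (prF y).
  by rewrite /d2' linearP; apply/matrixP => i j; rewrite !mxE.
apply: inT_linear => i.
by rewrite prG_linear (linearP (dG D i 2%N)) (linearP (q1 D i)) opprD addrACA
  scalerBr.
Qed.

Fact ell3_linear : linear ell3.
Proof.
move=> a x y; rewrite /ell3 prF_linear linearP.
apply: inT_linear => i.
by rewrite prG_linear (linearP (dG D i 3%N)) (linearP (q2 D i)) addrACA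
  scalerDr.
Qed.

HB.instance Definition _ :=
  GRing.isLinear.Build R 'rV[R]_(rkT 1) 'rV[R]_(rkT 0) *:%R ell1 ell1_linear.
HB.instance Definition _ :=
  GRing.isLinear.Build R 'rV[R]_(rkT 2) 'rV[R]_(rkT 1) *:%R ell2 ell2_linear.
HB.instance Definition _ :=
  GRing.isLinear.Build R 'rV[R]_(rkT 3) 'rV[R]_(rkT 2) *:%R ell3 ell3_linear.

Definition dT : diffs R rkT := fun n =>
  match n return {linear 'rV[R]_(rkT n) -> 'rV[R]_(rkT n.-1)} with
  | 1 => ell1 | 2 => ell2 | 3 => ell3 | _ => \0
  end.

Section ProductForm.
Variable mulT : prods R rkT.

Local Notation F11 := (mulF D 1%N 1%N 2%N).
Local Notation F12 := (mulF D 1%N 2%N 3%N).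
Local Notation T11 := (mulT (i := 1%N) (j := 1%N) 2%N).
Local Notation T12 := (mulT (i := 1%N) (j := 2%N) 3%N).
Local Notation iF1 := (@inF R 0).
Local Notation iF2 := (@inF R 1).
Local Notation iG1 := (@inG R 0 _).
Local Notation iG2 := (@inG R 1 _).
Local Notation eF := (@F'_to_F R 1).

Record trimming_product_form : Prop := {
  form_f1f1 : forall f f' : 'rV[R]_(rkF' 1),
    prF (T11 (iF1 f) (iF1 f')) = F11 (eF f) (eF f') /\
    forall k, dG D k 2%N (prG k (T11 (iF1 f) (iF1 f'))) =
      q1 D k (F11 (eF f) (eF f'));
  form_f1g1 : forall (f : 'rV[R]_(rkF' 1)) i (g : 'rV[R]_(rkG i 1)),
    prF (T11 (iF1 f) (iG1 g)) = F11 (m1 g *: e0 i) (eF f) /\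
    forall k, dG D k 2%N (prG k (T11 (iF1 f) (iG1 g))) =
      deltaG (d1F' f *: g) k + m1 g *: q1 D k (F11 (e0 i) (eF f));
  form_g1g1 : forall i (g g' : 'rV[R]_(rkG i 1)),
    T11 (iG1 g) (iG1 g') =
    iG2 ((- d1e i) *: mulG D i 1%N 1%N 2%N g g');
  form_g1g1_lt : forall (i j : 'I_t) (g : 'rV[R]_(rkG i 1))
      (h : 'rV[R]_(rkG j 1)), (i < j)%N ->
    prF (T11 (iG1 g) (iG1 h)) = (m1 g * m1 h) *: F11 (e0 i) (e0 j) /\
    forall k, dG D k 2%N (prG k (T11 (iG1 g) (iG1 h))) =
      (m1 g * m1 h) *: q1 D k (F11 (e0 i) (e0 j))
      + deltaG ((m1 h * d1e j) *: g) k - deltaG ((m1 g * d1e i) *: h) k;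
  form_f1f2 : forall (f : 'rV[R]_(rkF' 1)) (x : 'rV[R]_(rkF' 2)),
    prF (T12 (iF1 f) (iF2 x)) = F12 (eF f) x /\
    forall k, dG D k 3%N (prG k (T12 (iF1 f) (iF2 x))) =
      - (prG k (T11 (iF1 f) (iF1 (d2' x)))
         - \sum_j prG k (T11 (iF1 f) (iG1 (q1 D j x)))
         + q2 D k (F12 (eF f) x));
  form_f1g2 : forall (f : 'rV[R]_(rkF' 1)) i (h : 'rV[R]_(rkG i 2)),
    prF (T12 (iF1 f) (iG2 h)) = 0 /\
    forall k, dG D k 3%N (prG k (T12 (iF1 f) (iG2 h))) =
      deltaG (d1F' f *: h) k - prG k (T11 (iF1 f) (iG1 (dG D i 2%N h)));
  form_g1g2 : forall i (g : 'rV[R]_(rkG i 1)) (h : 'rV[R]_(rkG i 2)),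
    T12 (iG1 g) (iG2 h) =
    @inG R 2 _ ((- d1e i) *: mulG D i 1%N 2%N 3%N g h);
  form_g1g2_neq : forall (i j : 'I_t) (g : 'rV[R]_(rkG i 1))
      (h : 'rV[R]_(rkG j 2)), i <> j ->
    prF (T12 (iG1 g) (iG2 h)) = 0 /\
    forall k, dG D k 3%N (prG k (T12 (iG1 g) (iG2 h))) =
      - prG k (T11 (iG1 g) (iG1 (dG D j 2%N h)))
      - deltaG ((m1 g * d1e i) *: h) k;
  form_g1f2 : forall i (g : 'rV[R]_(rkG i 1)) (x : 'rV[R]_(rkF' 2)),
    prF (T12 (iG1 g) (iF2 x)) = - F12 (m1 g *: e0 i) x /\
    forall k, dG D k 3%N (prG k (T12 (iG1 g) (iF2 x))) =
      - deltaG (d1e i *: mulG D i 1%N 1%N 2%N g (q1 D i x)) k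
      + prG k (T11 (iF1 (d2' x)) (iG1 g))
      + \sum_(l < t | l != i) prG k (T11 (iG1 g) (iG1 (q1 D l x)))
      + m1 g *: q2 D k (F12 (e0 i) x)
}.

End ProductForm.

End Trimming.

(* The summands of T (x)_R k in positive degrees: in degree n.+1, SumF is     *)
(* F_(n.+1) (x) k (or F_1' (x) k if n = 0), and SumG i is G^i_(n.+1) (x) k.   *)
Inductive summand (t : nat) := SumF | SumG of 'I_t.
Arguments SumF {t}.

Definition in_summand (R : comNzRingType) (k : fieldType)
    (D : trimming_data R) (s : summand (ntrim D)) (n : nat)
    (z : 'rV[k]_(rkT D n.+1)) : Prop :=
  match s with
  | SumF => exists u, z = inF u
  | SumG i => exists u : 'rV[k]_(rkG i n.+1), z = inG u
  end.

Definition listed_product (t : nat) (s : summand t) (i : nat) (s' : summand t)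
    (j : nat) : bool :=
  match s, i, s', j with
  | SumF, 1, SumF, 1 | SumF, 1, SumF, 2 | SumF, 1, SumG _, 1
  | SumG _, 1, SumF, 2 | SumF, 1, SumG _, 2 => true
  | _, _, _, _ => false
  end.

Definition is_graded_alg_hom (k : fieldType) (r s : nat -> nat)
    (oner : 'rV[k]_(r 0)) (mulr : prods k r)
    (ones : 'rV[k]_(s 0)) (muls : prods k s)
    (phi : forall n, 'rV[k]_(r n) -> 'rV[k]_(s n)) : Prop :=
  [/\ forall n, linear (phi n),
      phi 0%N oner = ones &
      forall i j n x y,
        phi n (mulr i j n x y) = muls i j n (phi i x) (phi j y)].

(* The standard graded setting: phi identifies k[x_1, ..., x_N] with R, pi is *)
(* the quotient by the irrelevant ideal, and every free module has a basis of *)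
(* homogeneous elements for which all maps and products are homogeneous of    *)
(* degree 0; the G^i enter T shifted by the degree of e_0^i.                  *)
Definition is_homogeneous (R : comNzRingType) (k : fieldType) (N : nat)
    (phi : {rmorphism {mpoly k[N]} -> R}) (a : int) (x : R) : Prop :=
  match a with
  | Posz n => exists2 p : {mpoly k[N]}, p \is n.-homog & phi p = x
  | Negz _ => x = 0
  end.

Section Graded.
Variables (R : comNzRingType) (k : fieldType) (N : nat).
Variable phi : {rmorphism {mpoly k[N]} -> R}.

Definition homogeneous_map (r s : nat) (dr : 'rV[int]_r) (ds : 'rV[int]_s)
    (h : 'rV[R]_r -> 'rV[R]_s) : Prop :=
  forall a b, is_homogeneous phi (dr 0 a - ds 0 b) (h (delta_mx 0 a) 0 b).

Definition homogeneous_diffs (r : nat -> nat)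
    (dg : forall n, 'rV[int]_(r n)) (d : diffs R r) : Prop :=
  forall n, homogeneous_map (dg n) (dg n.-1) (d n).

Definition homogeneous_prods (r : nat -> nat)
    (dg : forall n, 'rV[int]_(r n)) (mul : prods R r) : Prop :=
  forall i j n a b c, is_homogeneous phi (dg i 0 a + dg j 0 b - dg n 0 c)
    (mul i j n (delta_mx 0 a) (delta_mx 0 b) 0 c).

Definition degT (D : trimming_data R)
    (degF : forall n, 'rV[int]_(rkF D n))
    (degG : forall i n, 'rV[int]_(@rkG R D i n)) (n : nat) :
    'rV[int]_(rkT D n) :=
  match n with
  | 0 => 0
  | p.+1 => inT (F_to_F' (degF p.+1))
      (fun i => degG i p.+1 + const_mx (degF 1%N 0 (rshift (f1 D) i)))
  end.

Record homogeneous_data (D : trimming_data R) (mulT : prods R (rkT D))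
    (degF : forall n, 'rV[int]_(rkF D n))
    (degG : forall i n, 'rV[int]_(@rkG R D i n)) : Prop := {
  degF0 : degF 0%N = 0;
  degG0 : forall i, degG i 0%N = 0;
  homogeneous_dF : homogeneous_diffs degF (dF D);
  homogeneous_mulF : homogeneous_prods degF (mulF D);
  homogeneous_dG : forall i, homogeneous_diffs (degG i) (dG D i);
  homogeneous_mulG : forall i, homogeneous_prods (degG i) (mulG D i);
  homogeneous_q1 : forall i, homogeneous_map (degF 2%N)
    (degG i 1%N + const_mx (degF 1%N 0 (rshift (f1 D) i))) (q1 D i);
  homogeneous_q2 : forall i, homogeneous_map (degF 3%N)
    (degG i 2%N + const_mx (degF 1%N 0 (rshift (f1 D) i))) (q2 D i);
  homogeneous_mulT : homogeneous_prods (degT degF degG) mulT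
}.

End Graded.

Definition standard_graded_setting (R : comNzRingType) (k : fieldType)
    (pi : {rmorphism R -> k}) (D : trimming_data R) (mulT : prods R (rkT D)) :
    Prop :=
  exists (N : nat) (phi : {rmorphism {mpoly k[N]} -> R}),
    [/\ bijective phi,
        forall p, pi (phi p) = p@_0 &
        exists degF degG, homogeneous_data phi mulT degF degG].

(* Main.v *)
Require Import Defs.
From HB Require Import structures.
From mathcomp Require Import all_boot all_order all_algebra.

(** Reducing modulo [m] is applying [map_mx pi], so the condition [map_mx pi
    x = 0] plays the role of: x lies in [m] times the free module. By
    minimality every scalar [m1 g] and [d1e i] lies in [m]. All products of
    total degree at least 4 vanish, and in total degree at most 3 the only
    products of summands of positive degree that are not listed, up to the
    order of the factors, are G_1^i G_1^j and G_1^i G_2^j. For i = j the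
    explicit formulas carry the factor [d1e i] and nothing is left to prove.
    For i <> j the F-component is zero or divisible by [m1 g], and the
    G^l-component is the delicate one, since the form of the product
    prescribes only its image under the differential of G^l, and an element
    whose image lies in m^2 G_1 need not lie in m G_2.

    The idea is to compare the product with a model (lemma [g1g1_model]):
    the DG structure of G^l provides, for each g in G_1^i, an explicit
    linear map [c] on G_1^j with values in m G_2^l whose image under the
    differential is the prescribed one. By exactness the true product
    differs from [c] by an element of d(G_3^l), which lies in m G_2^l by
    minimality; this settles G_1 G_1 ([g1g1_residue]). For G_1 G_2, the
    value of d_3 on the product involves the true product at (g, d_2 y). Its
    discrepancy from the model there lifts along d_3 to an element of m G_3,
    because the discrepancy is linear with values in the cycles and the
    coordinates of d_2 y are in [m] ([exact_lift]); the model itself is, up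
    to the remaining explicit term, d_3 of an element of m G_3. As d_3 is
    injective, the product lies in m G_3 ([g1g2_residue]).

    For the algebra map T -> F, the difference between the image of a
    product and the product of the images is bilinear and graded
    commutative, so it has to vanish modulo [m] on summands only, in degrees
    (1, 1) and (1, 2). There the F-components of the products are
    prescribed: they agree with the products of F on the summands F, and are
    zero or divisible by some [m1 g] as soon as a factor from some G^i
    enters. *)

Set Implicit Arguments.
Unset Strict Implicit.
Unset Printing Implicit Defensive.

Import GRing.Theory.
Local Open Scope ring_scope.

(** * Linear functions and DG-algebras *)

(** Products and projections are only known to satisfy the predicate [linear];
    this gives access to the lemmas on bundled linear maps. *)
Lemma linear_as_map (R : pzRingType) (U V : lmodType R) (f : U -> V) :
  linear f -> exists g : {linear U -> V}, g =1 f.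
Proof.
move=> lf; pose L := GRing.isLinear.Build R U V _ f lf.
pose g : {linear U -> V} := HB.pack f L.
by exists g.
Qed.

Section DGA.
Variables (R : comNzRingType) (r : nat -> nat) (d : diffs R r).
Variables (one : 'rV[R]_(r 0)) (mul : prods R r).
Arguments mul : clear implicits.
Hypothesis A : is_dg_algebra d one mul.

Lemma dg_mulDl i j n x x' y :
  mul i j n (x + x') y = mul i j n x y + mul i j n x' y.
Proof. by have := dg_linearl A n y 1 x x'; rewrite !scale1r. Qed.

Lemma dg_mulDr i j n x y y' :
  mul i j n x (y + y') = mul i j n x y + mul i j n x y'.
Proof. by have := dg_linearr A n x 1 y y'; rewrite !scale1r. Qed.

Lemma dg_mul0l i j n y : mul i j n 0 y = 0.
Proof. by apply: (@addIr _ (mul i j n 0 y)); rewrite -dg_mulDl !add0r. Qed.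

Lemma dg_mul0r i j n x : mul i j n x 0 = 0.
Proof. by apply: (@addIr _ (mul i j n x 0)); rewrite -dg_mulDr !add0r. Qed.

Lemma dg_mulZl i j n a x y : mul i j n (a *: x) y = a *: mul i j n x y.
Proof. by have := dg_linearl A n y a x 0; rewrite dg_mul0l !addr0. Qed.

End DGA.

Section DGA3.
Variables (R : comNzRingType) (a b c : nat) (d : diffs R (rk3 a b c)).
Variable mul : prods R (rk3 a b c).
Arguments mul : clear implicits.
Hypothesis A : is_dg_algebra d (unit1 R) mul.

Lemma dg_scalarl n (u : 'rV[R]_(rk3 a b c 0%N)) x : mul 0%N n n u x = sc u *: x.
Proof.
have -> : u = sc u *: unit1 R.
  by apply/rowP => i; rewrite !mxE ord1 mulr1.
by rewrite (dg_mulZl A) (dg_mul1l A) /sc !mxE mulr1.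
Qed.

Lemma dg_scalarr n x (u : 'rV[R]_(rk3 a b c 0%N)) : mul n 0%N n x u = sc u *: x.
Proof.
by rewrite (dg_comm A) muln0 expr0 scale1r dg_scalarl.
Qed.

Lemma leibniz11 (x y : 'rV[R]_(rk3 a b c 1%N)) :
  d 2%N (mul 1%N 1%N 2%N x y) = sc (d 1%N x) *: y - sc (d 1%N y) *: x.
Proof.
have -> : d 2%N (mul 1%N 1%N 2%N x y) = mul 0%N 1%N 1%N (d 1%N x) y
    + (-1) ^+ 1 *: mul 1%N 0%N 1%N x (d 1%N y) := dg_leibniz A x y.
by rewrite dg_scalarl dg_scalarr expr1 scaleN1r.
Qed.

Lemma leibniz21 (x : 'rV[R]_(rk3 a b c 2%N)) (y : 'rV[R]_(rk3 a b c 1%N)) :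
  d 3%N (mul 2%N 1%N 3%N x y) = mul 1%N 1%N 2%N (d 2%N x) y + sc (d 1%N y) *: x.
Proof.
have -> : d 3%N (mul 2%N 1%N 3%N x y) = mul 1%N 1%N 2%N (d 2%N x) y
    + (-1) ^+ 2 *: mul 2%N 0%N 2%N x (d 1%N y) := dg_leibniz A x y.
by rewrite dg_scalarr sqrrN expr1n scale1r.
Qed.

End DGA3.

Lemma width0_eq (S : nmodType) n (x y : 'rV[S]_n) : n = 0%N -> x = y.
Proof. by move=> n0; subst n; apply/rowP => -[]. Qed.

(** * Reduction modulo the maximal ideal *)

Section Residue.
Variables (R : comNzRingType) (k : fieldType) (m : R -> Prop).
Variable pi : {rmorphism R -> k}.
Hypothesis hk : residue_field m pi.

Lemma row_lift n (u : 'rV[k]_n) : exists x, u = map_mx pi x.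
Proof.
have /fin_all_exists[f fE] (i : 'I_n) : exists x, pi x = u 0 i.
  exact: (hk.1).
by exists (\row_i f i); apply/rowP => i; rewrite !mxE fE.
Qed.

Lemma residue0 x : m x -> pi x = 0.
Proof. by move/(hk.2 x). Qed.

Lemma minimal_residue r (d : diffs R r) n x :
  minimal_complex m d -> map_mx pi (d n x) = 0.
Proof. by move=> md; apply/rowP => i; rewrite !mxE residue0. Qed.

Lemma map_mxZ0 n (x : 'rV[R]_n) c : pi c = 0 -> map_mx pi (c *: x) = 0.
Proof. by move=> c0; rewrite map_mxZ c0 scale0r. Qed.

(** It suffices to lift the values of [f] on the basis along d: the resulting
    linear lift sends a vector with coordinates in [m] to a combination of
    lifted basis values with coefficients in [m]. *)
Lemma exact_lift r (d : diffs R r) n p (f : 'rV[R]_p -> 'rV[R]_(r n.+1))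
    (x : 'rV[R]_p) :
  (forall y, d n.+1 y = 0 -> exists z, d n.+2 z = y) ->
  linear f -> (forall y, d n.+1 (f y) = 0) -> map_mx pi x = 0 ->
  exists2 w, f x = d n.+2 w & map_mx pi w = 0.
Proof.
move=> ex /linear_as_map[g gE] df0 x0.
have /fin_all_exists[w wE] (b : 'I_p) : exists z, d n.+2 z = f (delta_mx 0 b).
  exact/ex/df0.
exists (\sum_b x 0 b *: w b).
  rewrite -gE {1}(row_sum_delta x) !linear_sum; apply: eq_bigr => b _.
  by rewrite !linearZ gE wE.
rewrite raddf_sum big1 // => b _ /=; rewrite map_mxZ0 //.
by have := congr1 (fun z : 'rV_p => z 0 b) x0; rewrite !mxE.
Qed.

End Residue.

(** * Coordinates of the trimming complex *)

Section Trim.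
Variables (R : comNzRingType) (D : trimming_data R).
Implicit Types i j l : 'I_(ntrim D).

Lemma T_ext (S : nmodType) n (z z' : 'rV[S]_(rkT D n.+1)) :
  prF z = prF z' -> (forall l, prG l z = prG l z') -> z = z'.
Proof.
move=> eF eG; rewrite -[z]hsubmxK -[z']hsubmxK; congr row_mx; first exact: eF.
exact/mxrowP/eG.
Qed.

Lemma prF_inF (S : nmodType) n (u : 'rV[S]_(rkF' D n.+1)) : prF (inF u) = u.
Proof. exact: row_mxKl. Qed.

Lemma prF_inG (S : nmodType) n i (u : 'rV[S]_(rkG i n.+1)) : prF (inG u) = 0.
Proof. exact: row_mxKl. Qed.

Lemma prG_inT (S : nmodType) n (u : 'rV[S]_(rkF' D n.+1)) v l :
  prG l (inT u v) = v l.
Proof. by rewrite /prG row_mxKr mxrowK. Qed.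

Lemma prG_inF (S : nmodType) n (u : 'rV[S]_(rkF' D n.+1)) l :
  prG l (inF u) = 0.
Proof. exact: prG_inT. Qed.

Lemma prG_inG (S : nmodType) n i (u : 'rV[S]_(rkG i n.+1)) : prG i (inG u) = u.
Proof. by rewrite prG_inT dfwith_in. Qed.

Lemma prG_inG_neq (S : nmodType) n i l (u : 'rV[S]_(rkG i n.+1)) :
  i != l -> prG l (inG u) = 0.
Proof. by move=> il; rewrite prG_inT dfwith_out. Qed.

Lemma prF0 (S : nmodType) n : prF (0 : 'rV[S]_(rkT D n.+1)) = 0.
Proof. by apply/rowP => p; rewrite !mxE. Qed.

Lemma prG0 (S : nmodType) n l : prG l (0 : 'rV[S]_(rkT D n.+1)) = 0.
Proof. by apply/rowP => p; rewrite !mxE. Qed.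

Lemma inF0 (S : nmodType) n : inF (0 : 'rV[S]_(rkF' D n.+1)) = 0.
Proof. by apply: T_ext => [|l]; rewrite ?prF_inF ?prG_inF ?prF0 ?prG0. Qed.

Lemma inG0 (S : nmodType) n i : inG (0 : 'rV[S]_(rkG i n.+1)) = 0.
Proof.
apply: T_ext => [|l]; first by rewrite prF_inG prF0.
by case: (eqVneq i l) => [<-|il]; rewrite ?prG_inG ?prG_inG_neq ?prG0.
Qed.

Lemma inG_linear n i : linear (@inG R D R n i).
Proof.
move=> a u v; apply: T_ext => [|l].
  by rewrite prF_linear !prF_inG scaler0 addr0.
rewrite prG_linear; case: (eqVneq i l) => [<-|il]; first by rewrite !prG_inG.
by rewrite !prG_inG_neq // scaler0 addr0.
Qed.

Lemma map_prF (S S' : nmodType) (f : S -> S') n (z : 'rV[S]_(rkT D n.+1)) :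
  map_mx f (prF z) = prF (map_mx f z).
Proof. by apply/rowP => p; rewrite !mxE. Qed.

Lemma map_prG (S S' : nmodType) (f : S -> S') n l (z : 'rV[S]_(rkT D n.+1)) :
  map_mx f (prG l z) = prG l (map_mx f z).
Proof. by apply/rowP => p; rewrite !mxE. Qed.

Lemma map_inG (S S' : nmodType) (f : {additive S -> S'}) n i
    (u : 'rV[S]_(rkG i n.+1)) : map_mx f (inG u) = inG (map_mx f u).
Proof.
apply: T_ext => [|l]; first by rewrite -map_prF !prF_inG raddf0.
rewrite -map_prG; case: (eqVneq i l) => [<-|il]; first by rewrite !prG_inG.
by rewrite !prG_inG_neq // raddf0.
Qed.

Lemma map_T_to_F (S S' : nmodType) (f : {additive S -> S'}) n
    (x : 'rV[S]_(rkT D n)) : map_mx f (T_to_F x) = T_to_F (map_mx f x).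
Proof.
case: n x => [|[|n]] x //=; rewrite /prF ?map_row_mx ?map_lsubmx ?raddf0 //.
Qed.

Lemma T_to_F_linear (S : pzRingType) n : linear (@T_to_F R D S n).
Proof.
move=> a x y; case: n x y => [|[|n]] x y //=; rewrite /prF.
  by rewrite linearP scale_row_mx add_row_mx scaler0 addr0.
exact: linearP.
Qed.

Lemma T_split n (x : 'rV[R]_(rkT D n.+1)) :
  x = inF (prF x) + \sum_i inG (prG i x).
Proof.
have [pF pFE] := linear_as_map (@prF_linear R D n).
apply: T_ext => [|l]; rewrite -?pFE.
  rewrite raddfD raddf_sum /= !pFE prF_inF big1 ?addr0 // => i _.
  by rewrite pFE prF_inG.
have [pG pGE] := linear_as_map (@prG_linear R D n l).
rewrite -!pGE raddfD raddf_sum /= !pGE prG_inF add0r (bigD1 l) //= pGE prG_inG.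
rewrite big1 ?addr0 // => i il; rewrite pGE.
by rewrite prG_inG_neq.
Qed.

Lemma T_ind n (P : 'rV[R]_(rkT D n.+1) -> Prop) :
  (forall x y, P x -> P y -> P (x + y)) ->
  (forall u, P (inF u)) -> (forall i u, P (@inG R D R n i u)) -> forall x, P x.
Proof.
move=> PD PF PG x; rewrite (T_split x); apply: (PD) => //.
have P0 : P 0 by rewrite -inF0; apply: PF.
by apply: (big_ind P).
Qed.
End Trim.

(** * Products of elements of the summands G *)

Section Products.
Variables (R : comNzRingType) (k : fieldType) (m : R -> Prop).
Variable pi : {rmorphism R -> k}.
Variables (D : trimming_data R) (mulT : prods R (rkT D)).
Arguments mulT : clear implicits.
Hypothesis hk : residue_field m pi.
Hypothesis hD : is_trimming_data D.
Hypothesis hT : is_dg_algebra (dT D) (unit1 R) mulT.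
Hypothesis hform : trimming_product_form mulT.
Hypothesis hFmin : minimal_complex m (dF D).
Hypothesis hGmin : forall i, minimal_complex m (dG D i).
Implicit Types i j l : 'I_(ntrim D).

Local Notation T11 := (mulT 1%N 1%N 2%N).
Local Notation T12 := (mulT 1%N 2%N 3%N).
Local Notation e0F i j := (mulF D 1%N 1%N 2%N (e0 i) (e0 j)).

Lemma m1_residue i (g : 'rV[R]_(rkG i 1%N)) : pi (m1 g) = 0.
Proof. exact/(residue0 hk)/hGmin. Qed.

Lemma d1e_residue i : pi (d1e i) = 0.
Proof. exact/(residue0 hk)/hFmin. Qed.

Lemma m1_q1 i (x : 'rV[R]_(rkF D 2%N)) :
  m1 (q1 D i x) = @rsubmx R 1 (f1 D) (ntrim D) (dF D 2%N x) 0 i.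
Proof.
have /rowP/(_ (rshift (f1 D) i)) := q1P hD i x.
by rewrite /d0 !mxE (unsplitK (inr _)) !mxE !eqxx !mulr1.
Qed.

(** The Leibniz rule gives d(e_0^i e_0^j) = d_1(e_0^i) e_0^j - d_1(e_0^j) e_0^i;
    the right-hand side is its coefficient along e_0^l. *)
Lemma m1_q1_e0e0 i j l :
  m1 (q1 D l (e0F i j)) = d1e i * (l == j)%:R - d1e j * (l == i)%:R.
Proof.
rewrite m1_q1 (leibniz11 (dgF hD)) !mxE !(unsplitK (inr _)) !mxE /=.
by rewrite -!/(d1e _).
Qed.

(** The formula prescribed for i < j is symmetric under exchange of the factors
    up to the sign of graded commutativity, so it holds for all i <> j. *)
Lemma g1g1_neq i j (g : 'rV[R]_(rkG i 1%N)) (h : 'rV[R]_(rkG j 1%N)) : i != j ->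
  prF (T11 (inG g) (inG h)) = (m1 g * m1 h) *: e0F i j /\
  forall l, dG D l 2%N (prG l (T11 (inG g) (inG h))) =
    (m1 g * m1 h) *: q1 D l (e0F i j)
    + deltaG ((m1 h * d1e j) *: g) l - deltaG ((m1 g * d1e i) *: h) l.
Proof.
rewrite -val_eqE neq_ltn => /orP[ij|ji]; first exact: (form_g1g1_lt hform).
have [eF eG] := form_g1g1_lt hform h g ji.
have anti : T11 (inG g) (inG h) = - T11 (inG h) (inG g).
  by rewrite (dg_comm hT) expr1 scaleN1r.
have anti' : e0F i j = - e0F j i.
  by rewrite (dg_comm (dgF hD)) expr1 scaleN1r.
have [pF pFE] := linear_as_map (@prF_linear R D 1).
rewrite anti anti' -pFE raddfN /= pFE eF scalerN mulrC; split=> // l.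
have [pG pGE] := linear_as_map (@prG_linear R D 1 l).
rewrite -pGE raddfN /= pGE raddfN /= eG (raddfN (q1 D l)) scalerN.
rewrite opprB opprD addrA; congr (_ + _).
by rewrite addrC [m1 h * _]mulrC.
Qed.

Lemma deltaG_in n i (u : 'rV[R]_(rkG i n)) : deltaG u i = u.
Proof. exact: dfwith_in. Qed.

Lemma deltaG_out n i l (u : 'rV[R]_(rkG i n)) : i != l -> deltaG u l = 0.
Proof. exact: dfwith_out. Qed.

(** With x = q_1^l(e_0^i e_0^j), the model [c h] of the G^l-component of g h is
    m_1(h) g x if l = i, m_1(g) h x if l = j, the products being those of G^l,
    and m_1(g) m_1(h) y with y a lift of x along m_2 otherwise. The scalar
    m_1(x) is -d_1(e_0^j), d_1(e_0^i) or 0 respectively, so that the Leibniz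
    rule in G^l yields exactly the prescribed differential. The last property
    is what the products with G_2^j require: m_1 kills d_2 y, so [c] vanishes
    on d_2 y unless l = j, in which case the Leibniz rule for y x shows that
    the explicit term completes it to d_3 (m_1(g) y x). *)
Lemma g1g1_model i j l (g : 'rV[R]_(rkG i 1%N)) : i != j ->
  exists c : 'rV[R]_(rkG j 1%N) -> 'rV[R]_(rkG l 2%N),
  [/\ linear c,
      forall h, dG D l 2%N (c h) = dG D l 2%N (prG l (T11 (inG g) (inG h))),
      forall h, map_mx pi (c h) = 0 &
      forall y, exists2 z, map_mx pi z = 0 &
        dG D l 3%N z = c (dG D j 2%N y) + deltaG ((m1 g * d1e i) *: y) l].
Proof.
move=> ij; set x := q1 D l (e0F i j).
have xE : m1 x = d1e i * (l == j)%:R - d1e j * (l == i)%:R.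
  exact: m1_q1_e0e0.
have eG h := (g1g1_neq g h ij).2 l; rewrite -/x in eG.
have m1m2 y : m1 (dG D j 2%N y) = 0.
  have [_ dd] := dg_complex (dgG hD j).
  by rewrite /m1 /sc (dd 2%N) mxE.
have m1lin a (u v : 'rV[R]_(rkG j 1%N)) : m1 (a *: u + v) = a * m1 u + m1 v.
  by rewrite /m1 /sc linearP !mxE.
have Al := dgG hD l.
case: (eqVneq i l) => [il|il].
  subst l; rewrite eqxx (negbTE ij) mulr0 mulr1 sub0r in xE.
  exists (fun h => m1 h *: mulG D i 1%N 1%N 2%N g x); split.
  - by move=> a u v; rewrite m1lin scalerDl scalerA.
  - move=> h; rewrite eG linearZ /= (leibniz11 Al) -/(m1 g) -/(m1 x) xE.
    rewrite deltaG_in deltaG_out 1?eq_sym // subr0 scaleNr opprK scalerDr.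
    by rewrite !scalerA [m1 h * m1 g]mulrC.
  - by move=> h; rewrite (map_mxZ0 _ (m1_residue _)).
  - move=> y; exists 0; rewrite ?raddf0 // m1m2 scale0r deltaG_out 1?eq_sym //.
    by rewrite addr0.
case: (eqVneq j l) => [jl|jl].
  subst l; rewrite eqxx eq_sym (negbTE ij) mulr0 mulr1 subr0 in xE.
  exists (fun h => m1 g *: mulG D j 1%N 1%N 2%N h x); split.
  - move=> a u v; rewrite (dg_linearl Al) scalerDr !scalerA mulrC.
    by rewrite [a * _]mulrC.
  - move=> h; rewrite eG linearZ /= (leibniz11 Al) -/(m1 h) -/(m1 x) xE.
    by rewrite deltaG_in deltaG_out // addr0 scalerBr !scalerA.
  - by move=> h; rewrite (map_mxZ0 _ (m1_residue _)).
  - move=> y; exists (m1 g *: mulG D j 2%N 1%N 3%N y x).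
      by rewrite (map_mxZ0 _ (m1_residue _)).
    rewrite linearZ /= (leibniz21 Al) -/(m1 x) xE deltaG_in scalerDr.
    by rewrite scalerA.
rewrite ![l == _]eq_sym (negbTE il) (negbTE jl) !mulr0 subr0 in xE.
have [_ ex _] := resG hD l.
have [|y yE] := ex 0%N x.
  by apply/rowP => p; rewrite ord1 mxE.
exists (fun h => (m1 g * m1 h) *: y); split.
- by move=> a u v; rewrite m1lin mulrDr scalerDl scalerA mulrCA.
- by move=> h; rewrite eG !deltaG_out // subr0 addr0 linearZ /= yE.
- by move=> h; rewrite (map_mxZ0 _ _) // rmorphM m1_residue mul0r.
- move=> z; exists 0; rewrite ?raddf0 // m1m2 mulr0 scale0r deltaG_out //.
  by rewrite addr0.
Qed.

Lemma dG_inj i (x y : 'rV[R]_(rkG i 3%N)) :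
  dG D i 3%N x = dG D i 3%N y -> x = y.
Proof.
move=> xy; apply/eqP; rewrite -subr_eq0; apply/eqP.
have [_ ex _] := resG hD i.
have [|z <-] := ex 2%N (x - y); first by rewrite linearB xy subrr.
by rewrite (width0_eq z 0 erefl) linear0.
Qed.

(** The product and its model have the same differential, so they differ by a
    boundary, which vanishes modulo [m] by minimality. *)
Lemma g1g1_residue i j (g : 'rV[R]_(rkG i 1%N)) (h : 'rV[R]_(rkG j 1%N)) :
  map_mx pi (T11 (inG g) (inG h)) = 0.
Proof.
case: (eqVneq i j) => [ij|ij].
  subst j; rewrite (form_g1g1 hform) map_inG map_mxZ0.
    exact: inG0.
  by rewrite rmorphN d1e_residue oppr0.
apply: T_ext => [|l].
  rewrite -map_prF (g1g1_neq g h ij).1 map_mxZ0; last first.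
    by rewrite rmorphM m1_residue mul0r.
  by rewrite prF0.
have [c [_ cE c0 _]] := g1g1_model l g ij.
have [_ ex _] := resG hD l.
have [|w wE] := ex 1%N (prG l (T11 (inG g) (inG h)) - c h).
  by rewrite linearB cE subrr.
rewrite -map_prG -[prG l _](subrK (c h)) -wE raddfD /= c0 addr0.
by rewrite (minimal_residue hk) // prG0.
Qed.

(** The prescribed d_3 of the product is the sum of the discrepancy [f] between
    model and product at d_2 y, which is d_3 w, and of minus the expression
    which [g1g1_model] shows to be d_3 z. *)
Lemma g1g2_residue i j (g : 'rV[R]_(rkG i 1%N)) (y : 'rV[R]_(rkG j 2%N)) :
  map_mx pi (T12 (inG g) (inG y)) = 0.
Proof.
case: (eqVneq i j) => [ij|ij].
  subst j; rewrite (form_g1g2 hform) map_inG map_mxZ0.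
    exact: inG0.
  by rewrite rmorphN d1e_residue oppr0.
have [eF eG] := form_g1g2_neq hform g y (elimN eqP ij).
apply: T_ext => [|l].
  by rewrite -map_prF eF raddf0 prF0.
have [c [clin cE _ cz]] := g1g1_model l g ij.
have [_ ex _] := resG hD l.
have [z z0 zE] := cz y.
pose f h := c h - prG l (T11 (inG g) (inG h)).
have flin : linear f.
  move=> a u v; rewrite /f clin inG_linear (dg_linearr hT) prG_linear.
  by rewrite scalerBr opprD addrACA.
have [|w wE w0] :=
    exact_lift (ex 1%N) flin _ (minimal_residue hk y (hGmin (i := j))).
  by move=> h; rewrite linearB /= cE subrr.
rewrite -map_prG (_ : prG l _ = w - z).
  by rewrite raddfB /= z0 w0 subrr prG0.
apply: dG_inj; rewrite eG linearB /= zE -wE /f.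
by rewrite opprD addrA [c _ - _]addrC addrK.
Qed.

(** * Comparison with the algebra F *)

Lemma T_to_F_inF n (u : 'rV[R]_(rkF' D n.+1)) :
  T_to_F (inF u) = F'_to_F u.
Proof. by rewrite /= prF_inF. Qed.

Lemma T_to_F_inG n i (u : 'rV[R]_(rkG i n.+1)) : T_to_F (inG u) = 0.
Proof. by rewrite /= prF_inG; case: n u => //= _; exact: row_mx0. Qed.

Lemma T_to_F0 (S : pzRingType) n : T_to_F (0 : 'rV[S]_(rkT D n)) = 0.
Proof.
by have [t tE] := linear_as_map (@T_to_F_linear R D S n); rewrite -tE linear0.
Qed.

(** Its bilinearity and graded commutativity reduce multiplicativity of T -> F
    modulo [m] to pairs of summands. *)
Definition hom_defect p q n (x : 'rV[R]_(rkT D p)) (y : 'rV[R]_(rkT D q)) :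
    'rV[k]_(rkF D n) :=
  map_mx pi (T_to_F (mulT p q n x y) - mulF D p q n (T_to_F x) (T_to_F y)).
Arguments hom_defect : clear implicits.

Lemma hom_defectDl p q n x x' y :
  hom_defect p q n (x + x') y = hom_defect p q n x y + hom_defect p q n x' y.
Proof.
have [t tE] := linear_as_map (@T_to_F_linear R D R n).
have [tp tpE] := linear_as_map (@T_to_F_linear R D R p).
rewrite /hom_defect -!tE -!tpE (dg_mulDl hT) !raddfD /= (dg_mulDl (dgF hD)).
by rewrite opprD addrACA map_mxD.
Qed.

Lemma hom_defect_comm p q n x y :
  hom_defect p q n x y = (-1) ^+ (p * q) *: hom_defect q p n y x.
Proof.
have [t tE] := linear_as_map (@T_to_F_linear R D R n).
rewrite /hom_defect (dg_comm hT) (dg_comm (dgF hD)) -!tE linearZ /=.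
by rewrite -scalerBr map_mxZ rmorphXn rmorphN rmorph1.
Qed.

Lemma hom_defectDr p q n x y y' :
  hom_defect p q n x (y + y') = hom_defect p q n x y + hom_defect p q n x y'.
Proof. by rewrite !(hom_defect_comm _ x) hom_defectDl scalerDr. Qed.

Lemma hom_defect_scalar n c x : hom_defect 0%N n n c x = 0.
Proof.
have cE : c = sc c *: unit1 R by apply/rowP => i; rewrite !mxE ord1 mulr1.
have [t tE] := linear_as_map (@T_to_F_linear R D R n).
rewrite /hom_defect (dg_scalarl (dgF hD)) {1}cE (dg_mulZl hT) (dg_mul1l hT).
by rewrite -!tE linearZ /= subrr raddf0.
Qed.

Lemma hom_defect11 x y : hom_defect 1%N 1%N 2%N x y = 0.
Proof.
elim/T_ind: x => [x x' ex ex'|f|i g].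
- by rewrite hom_defectDl ex ex' addr0.
- elim/T_ind: y => [y y' ey ey'|f'|j h].
  + by rewrite hom_defectDr ey ey' addr0.
  + rewrite /hom_defect !T_to_F_inF /= (form_f1f1 hform _ _).1.
    by rewrite subrr raddf0.
  + rewrite /hom_defect T_to_F_inG (dg_mul0r (dgF hD)) subr0 /=.
    by rewrite (form_f1g1 hform _ _).1 (dg_mulZl (dgF hD)) map_mxZ0 ?m1_residue.
- elim/T_ind: y => [y y' ey ey'|f'|j h].
  + by rewrite hom_defectDr ey ey' addr0.
  + rewrite hom_defect_comm /hom_defect T_to_F_inG (dg_mul0r (dgF hD)) subr0 /=.
    rewrite (form_f1g1 hform _ _).1 (dg_mulZl (dgF hD)) map_mxZ0 ?m1_residue //.
    by rewrite scaler0.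
  + rewrite /hom_defect T_to_F_inG (dg_mul0l (dgF hD)) subr0 map_T_to_F.
    by rewrite g1g1_residue T_to_F0.
Qed.

Lemma hom_defect12 x y : hom_defect 1%N 2%N 3%N x y = 0.
Proof.
elim/T_ind: x => [x x' ex ex'|f|i g].
- by rewrite hom_defectDl ex ex' addr0.
- elim/T_ind: y => [y y' ey ey'|z|j h].
  + by rewrite hom_defectDr ey ey' addr0.
  + rewrite /hom_defect !T_to_F_inF /= (form_f1f2 hform _ _).1.
    by rewrite subrr raddf0.
  + rewrite /hom_defect T_to_F_inG (dg_mul0r (dgF hD)) subr0 /=.
    by rewrite (form_f1g2 hform _ _).1 raddf0.
- elim/T_ind: y => [y y' ey ey'|z|j h].
  + by rewrite hom_defectDr ey ey' addr0.
  + rewrite /hom_defect T_to_F_inG (dg_mul0l (dgF hD)) subr0 /=.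
    rewrite (form_g1f2 hform _ _).1 (dg_mulZl (dgF hD)) -scaleNr map_mxZ0 //.
    by rewrite rmorphN m1_residue oppr0.
  + rewrite /hom_defect T_to_F_inG (dg_mul0l (dgF hD)) subr0 map_T_to_F.
    by rewrite g1g2_residue T_to_F0.
Qed.

Lemma hom_defect_eq0 p q n x y : hom_defect p q n x y = 0.
Proof.
have [nE|/eqP nE] := eqVneq n (p + q)%N; last first.
  rewrite /hom_defect (dg_degree hT) // (dg_degree (dgF hD)) // T_to_F0.
  by rewrite subrr raddf0.
have [pq|pq] := ltnP 3 (p + q)%N.
  by subst n; apply: width0_eq; case: (p + q)%N pq => [|[|[|[|l]]]].
case: p q x y nE pq => [|p] [|q] x y nE pq.
- by rewrite add0n in nE; subst n; apply: hom_defect_scalar.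
- by rewrite add0n in nE; subst n; apply: hom_defect_scalar.
- rewrite addn0 in nE; subst n.
  by rewrite hom_defect_comm hom_defect_scalar scaler0.
case: p q x y nE pq => [|[|p]] [|[|q]] x y nE pq;
  rewrite ?(addnS, addSn) // in pq; subst n.
- exact: hom_defect11.
- exact: hom_defect12.
- by rewrite hom_defect_comm hom_defect12 scaler0.
Qed.

Lemma T_to_F_mulT p q n x y :
  map_mx pi (T_to_F (mulT p q n x y))
  = map_mx pi (mulF D p q n (T_to_F x) (T_to_F y)).
Proof.
apply/eqP; rewrite -subr_eq0 -map_mxB -/(hom_defect _ _ _ _ _).
by rewrite hom_defect_eq0.
Qed.

(** * Vanishing products modulo the maximal ideal *)

Lemma mulT_degree_ge4 p q n x y : (3 < p + q)%N -> mulT p q n x y = 0.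
Proof.
move=> pq; have [nE|/eqP nE] := eqVneq n (p + q)%N; last exact: (dg_degree hT).
subst n; apply: width0_eq; case: (p + q)%N pq => [|[|[|[|l]]]] //= _.
by rewrite big1.
Qed.

Lemma mul_in_summand (s s' : summand (ntrim D)) p q n
    (u : 'rV[k]_(rkT D p.+1)) (v : 'rV[k]_(rkT D q.+1)) :
  in_summand s u -> in_summand s' v ->
  base_change pi mulT n u v <> 0 ->
  listed_product s p.+1 s' q.+1 || listed_product s' q.+1 s p.+1.
Proof.
have lift r z : exists x : 'rV[R]_(rkT D r.+1), z = map_mx pi x.
  exact: (row_lift hk).
have liftG i r (w : 'rV[k]_(rkG i r.+1)) :
    exists x : 'rV[R]_(rkG i r.+1), inG w = map_mx pi (inG x).
  have [x ->] := row_lift hk w; by exists x; rewrite map_inG.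
have [nE|/eqP nE] := eqVneq n (p.+1 + q.+1)%N; last first.
  move=> _ _; have [x ->] := lift _ u; have [y ->] := lift _ v.
  by rewrite (base_changeE _ _ _ _ hT) (dg_degree hT) // raddf0.
have [pq|pq] := ltnP 3 (p.+1 + q.+1).
  move=> _ _; have [x ->] := lift _ u; have [y ->] := lift _ v.
  by rewrite (base_changeE _ _ _ _ hT) mulT_degree_ge4 // raddf0.
case: s s' => [|i] [|j]; last first.
  move=> [u' ->] [v' ->].
  have [x ->] := liftG _ _ u'; have [y ->] := liftG _ _ v'.
  rewrite (base_changeE _ _ _ _ hT) {u v u' v'}; subst n.
  case: p q x y pq => [|[|p]] [|[|q]] x y pq;
    rewrite ?(addnS, addSn) // in pq.
  - by rewrite g1g1_residue.
  - by rewrite g1g2_residue.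
  - by rewrite (dg_comm hT) map_mxZ g1g2_residue scaler0.
all: move=> _ _ _; case: p q {u v nE} pq => [|[|p]] [|[|q]] //.
all: by rewrite ?(addnS, addSn).
Qed.

Lemma T_to_F_hom : is_graded_alg_hom (unit1 k) (base_change pi mulT)
    (unit1 k) (base_change pi (mulF D)) (@T_to_F R D k).
Proof.
split=> [n|//|p q n x y]; first exact: T_to_F_linear.
have [x' ->] := row_lift hk x; have [y' ->] := row_lift hk y.
rewrite (base_changeE _ _ _ _ hT) -!map_T_to_F.
by rewrite (base_changeE _ _ _ _ (dgF hD)) T_to_F_mulT.
Qed.
End Products.

Theorem corollary3p5 (R : comNzRingType) (k : fieldType) (m : R -> Prop)
    (pi : {rmorphism R -> k}) (D : trimming_data R) (mulT : prods R (rkT D))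
    (hk : residue_field m pi)
    (hR : regular_local_ring m \/ standard_graded_setting pi mulT)
    (hD : is_trimming_data D)
    (hT : is_dg_algebra (dT D) (unit1 R) mulT)
    (hform : trimming_product_form mulT)
    (hFmin : minimal_complex m (dF D))
    (hGmin : forall i, minimal_complex m (dG D i)) :
  (forall (s s' : summand (ntrim D)) (i j n : nat)
     (u : 'rV[k]_(rkT D i.+1)) (v : 'rV[k]_(rkT D j.+1)),
     in_summand s u -> in_summand s' v ->
     base_change pi mulT n u v <> 0 ->
     listed_product s i.+1 s' j.+1 || listed_product s' j.+1 s i.+1)
  /\
  is_graded_alg_hom
    (unit1 k) (base_change pi mulT)
    (unit1 k) (base_change pi (mulF D))
    (@T_to_F R D k).
Proof.
split; last exact: (T_to_F_hom hk hD hT hform hFmin hGmin).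
move=> s s' i j n u v; exact: (mul_in_summand hk hD hT hform hFmin hGmin).
Qed.
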